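(* Let $\mathcal{P}_4$ be the set of partitions $\lambda=(\lambda_1>\cdots>\lambda_\ell)$ into distinct positive parts such that for each $1\le i<\ell$: $\lambda_i-\lambda_{i+1}\equiv2\pmod 4$ if both are odd; $\equiv0\pmod 4$ if both are even; $\equiv3\pmod 4$ if they have different parity; and the smallest part $\lambda_\ell\equiv1$ or $2\pmod 4$ (empty partition included). Then $$\sum_{\lambda\in\mathcal{P}_4}x^{o(\lambda)}(-1)^{e(\lambda)}q^{|\lambda|}=\sum_{n=0}^{\infty}\frac{(q/x;q^2)_{n}x^nq^{n^{2}}}{(q^4;q^4)_{n}}=\frac{(-xq;q^2)_{\infty}}{(-q^2;q^2)_{\infty}}.$$
   Context: $o(\lambda)$, $e(\lambda)$ are the numbers of odd and even parts of $\lambda$, $|\lambda|$ the sum of its parts, $(a;q)_n=\prod_{i=0}^{n-1}(1-aq^i)$ for $n\in\mathbb{Z}_{\ge0}\cup\{\infty\}$, $|q|<1$. *)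

(* Defs.v *)
From mathcomp Require Import all_boot all_order all_algebra finmap.
From mathcomp Require Import complex.
From mathcomp Require Import all_classical all_reals all_analysis.
From mathcomp Require Import summability.
Import numFieldNormedType.Exports.

Set Implicit Arguments.
Unset Strict Implicit.
Unset Printing Implicit Defensive.

Import Order.TTheory GRing.Theory Num.Theory.
Local Open Scope classical_set_scope.
Local Open Scope ring_scope.

Definition qpoch (C : numFieldType) (a q : C) (n : nat) : C :=
  \prod_(i < n) (1 - a * q ^+ i).

(* [lim] has a junk value on divergent sequences: a statement about [qpoch_inf]
   should come with the convergence of [qpoch a q n] as n tends to infinity. *)
Definition qpoch_inf (C : numFieldType) (a q : C) : C :=
  lim (qpoch a q n @[n --> \oo]).

Definition gap_residue (a b : nat) : nat :=
  if odd a && odd b then 2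
  else if ~~ odd a && ~~ odd b then 0 else 3.

(* [a] is the part preceding [b]. The truncated subtraction is harmless since
   [is_P4] also requires [b < a]. *)
Definition P4_gap (a b : nat) : bool := (a - b == gap_residue a b %[mod 4])%N.

(* A partition is the strictly decreasing list of its (positive) parts. *)
Definition is_P4 (s : seq nat) : bool :=
  [&& sorted gtn s, all (leq 1) s, sorted P4_gap s
    & (s != [::]) ==> ((last 0 s %% 4 == 1) || (last 0 s %% 4 == 2))]%N.

Definition P4 := {s : seq nat | is_P4 s}.

Definition nb_odd (s : seq nat) : nat := count odd s.
Definition nb_even (s : seq nat) : nat := count (predC odd) s.

Definition P4_weight (C : numFieldType) (x q : C) (l : P4) : C :=
  x ^+ nb_odd (val l) * (-1) ^+ nb_even (val l) * q ^+ sumn (val l).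

Definition has_sum (I : choiceType) (C : numFieldType) (f : I -> C) (v : C) :
  Prop := partial_sum f A @[A --> totally] --> v.

(* Main.v *)
(* A partition in P_4 is determined by its smallest part, congruent to 1 or 2
   modulo 4, and by the partition in P_4 left after removing that part and
   shifting the others down by an even amount.  With n parts remaining, the
   choice of the smallest part contributes the factor
     q^(2n+1) (x - q^(2n+1)) / (1 - q^(4(n+1))),
   a geometric series; hence the partitions with n parts add up to the n-th
   term of the series.  The evaluation as a product is the limit N -> oo of the
   q-Chu-Vandermonde sum
     sum_n [N, n]_b prod_(i < n) b^i (c b^i - z) / (1 - c b^i)
       = (z; b)_N / (c; b)_N,     b = q^2,  c = - q^2,  z = - x q.
   Both limits follow from Tannery's theorem, all terms being dominated by
   products of the form prod_(i < n) C |q|^i. *)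
Require Import Defs.
From mathcomp Require Import all_boot all_order all_algebra finmap.
From mathcomp Require Import complex.
From mathcomp Require Import all_classical all_reals all_analysis.
From mathcomp Require Import zify ring.
Import numFieldNormedType.Exports.
Import Order.TTheory GRing.Theory Num.Theory.
Local Open Scope classical_set_scope.
Local Open Scope complex_scope.
Local Open Scope ring_scope.

(** * The finite q-Chu-Vandermonde sum *)

Definition qterm {F : fieldType} (b c z : F) (i : nat) : F :=
  b ^+ i * (c * b ^+ i - z) / (1 - c * b ^+ i).

(** The Gaussian binomial, written over [i < n] so that it merges factor by factor with the product
    of the [qterm]. For [n > N] the factor of index [N] is [1 - b ^+ 0 = 0], so the truncated
    subtraction does no harm. *)
Definition qbinom {F : fieldType} (b : F) (N n : nat) : F :=
  \prod_(i < n) ((1 - b ^+ (N - i)) / (1 - b ^+ i.+1)).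

Lemma qbinom_gt (F : fieldType) (b : F) N : qbinom b N N.+1 = 0.
Proof. by rewrite /qbinom big_ord_recr /= subnn expr0 subrr mul0r mulr0. Qed.

(** After the common factors are removed, this is [1 - b^(N+1) = (1 - b^(n+1)) + b^(n+1) (1 -
    b^(N-n))]. *)
Lemma qbinomS (F : fieldType) (b : F) N n :
  (forall i, b ^+ i.+1 != 1) -> (n <= N)%N ->
  qbinom b N.+1 n.+1 = qbinom b N n + b ^+ n.+1 * qbinom b N n.+1.
Proof.
move=> b1 le_nN; have nz i : 1 - b ^+ i.+1 != 0 by rewrite subr_eq0 eq_sym.
rewrite /qbinom !big_split /= big_ord_recl /= subn0.
rewrite (eq_bigr (fun i : 'I_n => 1 - b ^+ (N - i))) //.
rewrite !big_ord_recr /=; set P := \prod_(i < n) _; set Q := \prod_(i < n) _.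
have -> : b ^+ N.+1 = b ^+ n.+1 * b ^+ (N - n) by rewrite -exprD addSn subnKC.
by field; rewrite nz.
Qed.

(* Pascal's rule pairs the terms of index [n] and [n + 1]; each pair collapses
   to [1 - z] times a term of the same sum at [(c b, z b)]. *)
Lemma qbinom_sum (F : fieldType) (b : F) N : (forall i, b ^+ i.+1 != 1) ->
  forall c z, (forall i, 1 - c * b ^+ i != 0) ->
  \sum_(n < N.+1) qbinom b N n * \prod_(i < n) qterm b c z i =
    \prod_(i < N) ((1 - z * b ^+ i) / (1 - c * b ^+ i)).
Proof.
move=> b1; elim: N => [|N IH] c z c1.
  by rewrite big_ord1 /qbinom !big_ord0 mulr1.
have c1' i : 1 - c * b * b ^+ i != 0 by rewrite -mulrA -exprS.
rewrite [RHS]big_ord_recl /= expr0 !mulr1.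
have -> : \prod_(i < N) ((1 - z * b ^+ bump 0 i) / (1 - c * b ^+ bump 0 i)) =
    \prod_(i < N) ((1 - z * b * b ^+ i) / (1 - c * b * b ^+ i)).
  by apply: eq_bigr => i _; rewrite /bump leq0n add1n exprS !mulrA.
rewrite -IH // mulr_sumr.
have qbinom0 M : qbinom b M 0 = 1 by rewrite /qbinom big_ord0.
rewrite big_ord_recl /= qbinom0 big_ord0 mulr1.
have pascal (n : 'I_N.+1) : qbinom b N.+1 (lift ord0 n) *
      \prod_(i < lift ord0 n) qterm b c z i =
    qbinom b N n * \prod_(i < n.+1) qterm b c z i +
    b ^+ n.+1 * qbinom b N n.+1 * \prod_(i < n.+1) qterm b c z i.
  rewrite lift0 qbinomS //; first by rewrite mulrDl.
  by rewrite -ltnS.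
under eq_bigr do rewrite pascal.
rewrite big_split /= addrCA.
(* The leading 1 becomes the term of index 0, and the top term vanishes by [qbinom_gt]; both halves
   of Pascal's rule now run over the same range. *)
have -> : 1 + \sum_(n < N.+1)
      b ^+ n.+1 * qbinom b N n.+1 * \prod_(i < n.+1) qterm b c z i =
    \sum_(n < N.+1) b ^+ n * qbinom b N n * \prod_(i < n) qterm b c z i.
  rewrite [RHS]big_ord_recl [in LHS]big_ord_recr /= qbinom_gt mulr0 mul0r addr0.
  by rewrite qbinom0 big_ord0 expr0 !mulr1.
rewrite -big_split /=; apply: eq_bigr => n _.
(* Passing to [(c b, z b)] multiplies [qterm] of index [i] by [b (1 - c b^i) / (1 - c b^(i+1))],
   which telescopes. *)
have shift : b ^+ n * \prod_(i < n) qterm b c z i / (1 - c * b ^+ n) =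
    \prod_(i < n) qterm b (c * b) (z * b) i / (1 - c).
  have c0 : 1 - c != 0 by have := c1 0%N; rewrite mulr1.
  elim: (nat_of_ord n) => [|m IHm]; first by rewrite !big_ord0 !mulr1.
  rewrite !big_ord_recr /= -[RHS]mulrAC -IHm /qterm.
  have := c1' m; have := c1 m; rewrite !exprS => ? ?.
  by field; rewrite ?mulrA; apply/andP; split.
rewrite (_ : \prod_(i < n) qterm b (c * b) (z * b) i =
    b ^+ n * \prod_(i < n) qterm b c z i / (1 - c * b ^+ n) * (1 - c));
  last first.
  by rewrite shift divfK //; have := c1 0%N; rewrite mulr1.
(* The pair collapses because [(c b^n - z) + (1 - c b^n) = 1 - z]. *)
rewrite big_ord_recr /= /qterm.
have := c1 0%N; have := c1 n; rewrite mulr1 => ? ?.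
by field; apply/andP; split.
Qed.

(** * Coding of the partitions by words *)

Definition P4_part (a : bool * nat) : nat :=
  (4 * a.2 + (if a.1 then 1 else 2))%N.

(** The least admissible odd and even parts above [P4_part a] are [P4_shift a + 1] and
    [P4_shift a + 2]. Subtracting this even number thus turns the gap condition on the next part
    into the condition on a smallest part. *)
Definition P4_shift (a : bool * nat) : nat :=
  (4 * a.2 + (if a.1 then 2 else 4))%N.

Lemma odd_P4_part a : odd (P4_part a) = a.1.
Proof. by case: a => [[] j]; rewrite /P4_part oddD oddM. Qed.

Lemma odd_P4_shift a : odd (P4_shift a) = false.
Proof. by case: a => [[] j]; rewrite /P4_shift oddD oddM. Qed.

Definition P4_prepend (a : bool * nat) (m : seq nat) : seq nat :=
  P4_part a :: map (addn (P4_shift a)) m.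

(* A letter [(p, j)] records a smallest part: odd iff [p], and with quotient [j]
   modulo 4.  The word [c] is read from the smallest part up, so the parts come
   out in increasing order. *)
Definition P4_parts (c : seq (bool * nat)) : seq nat := foldr P4_prepend [::] c.

Definition P4_succ : rel nat := fun b a => (b < a)%N && P4_gap a b.

Definition is_P4_rev (m : seq nat) : bool :=
  if m is a :: m' then
    ((a %% 4 == 1) || (a %% 4 == 2))%N && path P4_succ a m' else true.

Lemma is_P4E s : is_P4 s = is_P4_rev (rev s).
Proof.
rewrite /is_P4 -[s in LHS]revK; case: (rev s) => [|a m] //.
rewrite !rev_sorted.
have -> : rev (a :: m) != [::] by rewrite -size_eq0 size_rev.
rewrite rev_cons last_rcons all_rcons all_rev /=.
have -> : path P4_succ a m =
    path ltn a m && path (fun b a => P4_gap a b) a m.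
  elim: m a => //= c m IH a; rewrite IH /P4_succ.
  by rewrite -!andbA; congr (_ && _); rewrite andbCA.
case ltm: (path ltn a m); last by rewrite andbF.
case am: (_ || _); last by rewrite !andbF.
(* Positivity of all parts comes from the residue of the smallest one. *)
have a_gt0 : (0 < a)%N by case: (a) am.
rewrite a_gt0 andbT /= (sub_all _ (order_path_min ltn_trans ltm)) //.
by move=> x /(leq_trans _)-> //.
Qed.

Lemma P4_succ_part a b : P4_succ (P4_part a) b =
  (P4_part a < b)%N &&
  (b - P4_part a ==
    (if a.1 then if odd b then 2 else 3 else if odd b then 3 else 0)
    %[mod 4])%N.
Proof.
rewrite /P4_succ /P4_gap /gap_residue odd_P4_part.
by case: a.1; case: (odd b).
Qed.

Lemma P4_succ_shift a m b :
  P4_succ (P4_shift a + m) (P4_shift a + b) = P4_succ m b.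
Proof.
rewrite /P4_succ ltn_add2l /P4_gap subnDl /gap_residue.
by rewrite (oddD _ m) (oddD _ b) odd_P4_shift.
Qed.

(** An even shift preserves the gaps inside [m], and the new gap is admissible exactly when the head
    of [m] is 1 or 2 modulo 4. *)
Lemma is_P4_rev_prepend a m : is_P4_rev (P4_prepend a m) = is_P4_rev m.
Proof.
have part_mod : ((P4_part a %% 4 == 1) || (P4_part a %% 4 == 2))%N.
  by case: a => [[] j]; rewrite /P4_part /= mulnC modnMDl.
case: m => [|m s] /=; first by rewrite part_mod.
rewrite part_mod /= path_map; congr (_ && _); last first.
  by apply: eq_path => x y; rewrite /= P4_succ_shift.
rewrite P4_succ_part (oddD _ m) odd_P4_shift /=.
rewrite /P4_part /P4_shift.
by case: a {part_mod} => [[] j] /=; case: ifP; lia.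
Qed.

Lemma is_P4_parts c : is_P4_rev (P4_parts c).
Proof. by elim: c => // a c IH; exact: etrans (is_P4_rev_prepend a _) IH. Qed.

Lemma P4_part_onto s : ((s %% 4 == 1) || (s %% 4 == 2))%N ->
  exists a, s = P4_part a.
Proof.
rewrite /P4_part; case/orP => /eqP s4.
  by exists (true, s %/ 4)%N; rewrite /= {1}(divn_eq s 4) s4; lia.
by exists (false, s %/ 4)%N; rewrite /= {1}(divn_eq s 4) s4; lia.
Qed.

Lemma P4_parts_onto m : is_P4_rev m -> exists c, m = P4_parts c.
Proof.
have [n] := ubnP (size m); elim: n m => // n IH [|s m] /= sz mP4.
  by exists [::].
have [/P4_part_onto[a sE] pm] := andP mP4.
(* Every later part is at least the shift, so the truncated subtraction below can be undone. *)
have shift_le : all (leq (P4_shift a)) m.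
  case: m pm {sz mP4} => //= b m /andP[sb pm].
  have ab : (P4_shift a <= b)%N.
    move: sb; rewrite {}sE P4_succ_part /P4_part /P4_shift.
    by case: a => [[] j] /=; case: ifP; lia.
  rewrite ab /=.
  have : path ltn b m by apply: sub_path pm => x y /andP[].
  move/(order_path_min ltn_trans); apply: sub_all => x /ltnW; exact: leq_trans.
have mE : m = map (addn (P4_shift a)) (map (subn^~ (P4_shift a)) m).
  rewrite -map_comp -[LHS]map_id; apply/eq_in_map => x xm /=.
  by rewrite subnKC //; exact: (allP shift_le).
have [||c cE] := IH (map (subn^~ (P4_shift a)) m).
- by rewrite size_map.
- by rewrite -(is_P4_rev_prepend a) /P4_prepend -mE -sE.
- by exists (a :: c); rewrite /= -cE /P4_prepend -mE -sE.
Qed.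

Lemma P4_parts_inj : injective P4_parts.
Proof.
elim=> [|a c IH] [|b d] //= [part_ab].
have -> : a = b.
  move: a b part_ab {IH} => [[] i] [[] j]; rewrite /P4_part /= => ?.
  - by congr (_, _); lia.
  - by lia.
  - by lia.
  - by congr (_, _); lia.
by move/(inj_map (@addnI (P4_shift b))) => /IH->.
Qed.

Lemma size_P4_parts c : size (P4_parts c) = size c.
Proof. by elim: c => //= a c IH; rewrite size_map IH. Qed.

(** * Generating function of the words of given length *)

(** The variable [y] is -1 for the signed weight and 1 for its norm, where [x] and [q] are replaced
    by their norms. *)
Definition parts_weight {S : comPzRingType} (x y q : S) (s : seq nat) : S :=
  x ^+ nb_odd s * y ^+ nb_even s * q ^+ sumn s.

Lemma parts_weight_prepend (S : comPzRingType) (x y q : S) a m :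
  parts_weight x y q (P4_prepend a m) =
  (if a.1 then x else y) * q ^+ (P4_part a + size m * P4_shift a)
    * parts_weight x y q m.
Proof.
rewrite /parts_weight /nb_odd /nb_even /= !count_map.
rewrite (eq_count (a2 := odd)); last by move=> k; rewrite /= oddD odd_P4_shift.
rewrite (eq_count (a1 := preim _ _) (a2 := predC odd)); last first.
  by move=> k; rewrite /= oddD odd_P4_shift.
have -> : sumn (map (addn (P4_shift a)) m) = (size m * P4_shift a + sumn m)%N.
  by elim: m => //= k m ->; lia.
rewrite odd_P4_part addnA [in LHS]exprD.
rewrite exprD [q ^+ (_ + _ + _)]exprD.
move: (x ^+ count odd m) (y ^+ count _ m) (q ^+ (_ + _)) (q ^+ sumn m).
by case: a.1 => u v w t; rewrite expr1 expr0 /=; ring.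
Qed.

Definition P4_letters (N : nat) : seq (bool * nat) :=
  [seq (o, j) | o <- [:: true; false], j <- iota 0 N].

Fixpoint P4_words (N n : nat) : seq (seq (bool * nat)) :=
  if n is n'.+1 then [seq a :: c | a <- P4_letters N, c <- P4_words N n']
  else [:: [::]].

Lemma P4_wordsP N n c :
  (c \in P4_words N n) = (size c == n) && all (fun a => a.2 < N)%N c.
Proof.
elim: n c => [|n IH] [|a c] //=.
  by apply/negbTE/negP => /allpairsP[[b d] []].
apply/allpairsP/idP => [[[b d] /= [bN dP [-> ->]]]|].
  rewrite eqSS andbCA -IH dP andbT.
  by case/allpairsP: bN => [[p j] /= [_ jN ->]]; rewrite mem_iota in jN.
rewrite eqSS andbCA -IH => /andP[aN cP]; exists (a, c); split=> //=.
apply/allpairsP; exists a; case: a aN => [[] j] /= jN; split=> //.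
  by rewrite mem_iota.
by rewrite mem_iota.
Qed.

Lemma uniq_P4_words N n : uniq (P4_words N n).
Proof.
elim: n => // n IH /=; apply: allpairs_uniq => //; last first.
  by case=> ? ? [? ?] _ _ [-> ->].
by apply: allpairs_uniq; rewrite ?iota_uniq // => -[? ?] [? ?] _ _ [-> ->].
Qed.

(** The factor contributed by a prepended letter depends on the rest of the word only through its
    length, so the sum factors. Bounding the quotients by [N] leaves truncated geometric sums. *)
Lemma sum_P4_words (S : comPzRingType) (x y q : S) N n :
  \sum_(c <- P4_words N n) parts_weight x y q (P4_parts c) =
  \prod_(i < n) (q ^+ i.*2.+1 * (x + y * q ^+ i.*2.+1)
                 * \sum_(j < N) (q ^+ (4 * i.+1)) ^+ j).
Proof.
elim: n => [|n IH]; first by rewrite big_seq1 big_ord0 /parts_weight /= !mulr1.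
rewrite /= big_allpairs_dep /= big_ord_recr /= -IH.
have step a : a \in P4_letters N ->
   \sum_(c <- P4_words N n) parts_weight x y q (P4_parts (a :: c)) =
   (\sum_(c <- P4_words N n) parts_weight x y q (P4_parts c)) *
    ((if a.1 then x else y) * q ^+ (P4_part a + n * P4_shift a)).
  move=> _; rewrite mulr_suml big_seq [RHS]big_seq; apply: eq_bigr => c.
  rewrite P4_wordsP => /andP[/eqP <- _].
  by rewrite parts_weight_prepend size_P4_parts mulrC.
rewrite big_seq (eq_bigr _ step) -big_seq -mulr_sumr; congr (_ * _).
rewrite /P4_letters big_allpairs_dep /= !big_cons big_nil addr0.
have -> : iota 0 N = index_iota 0 N by rewrite /index_iota subn0.
rewrite !big_mkord -big_split /= mulr_sumr.
(* The exponents are [4j+1 + n(4j+2) = (2n+1) + 4(n+1)j] for an odd letter and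
   [4j+2 + n(4j+4) = 2(2n+1) + 4(n+1)j] for an even one. *)
apply: eq_bigr => j _; rewrite /P4_part /P4_shift /= -exprM.
rewrite mulrDr mulrDl; congr (_ + _).
  by rewrite [RHS]mulrAC -exprD [RHS]mulrC; congr (_ * q ^+ _); lia.
rewrite mulrCA -[RHS]mulrA -!exprD; congr (_ * q ^+ _); lia.
Qed.

(* The topology is attached to the sort of a [numFieldType], so it is not found
   on the bare type [R[i]]. *)
Local Notation cplx R :=
  (Num.NumField.sort (complex_complex__canonical__Num_NumField R)).

(** * Convergence and bounds over the complex numbers *)

Lemma ge0_complexE {R : realType} (z : cplx R) :
  0 <= z -> z = (complex.Re z)%:C.
Proof. by move=> /ger0_real /RRe_real. Qed.

Lemma cvg_complex_of_real {R : realType} {T : Type} {F : set_system T}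
    {FF : Filter F} {f : T -> R} {l : R} :
  f t @[t --> F] --> l -> ((f t)%:C : cplx R) @[t --> F] --> (l%:C : cplx R).
Proof.
move=> fl; apply/cvgrPdist_lt => e e0.
have eE := ge0_complexE _ (ltW e0); rewrite eE ltcR in e0.
move/cvgrPdist_lt : fl => /(_ _ e0); apply: filterS => t.
by rewrite -raddfB /= normc_def /= expr0n addr0 sqrtr_sqr eE ltcR.
Qed.

Lemma cvg_complex {R : realType} (f : nat -> cplx R) (a b : R) :
  complex.Re (f n) @[n --> \oo] --> a -> complex.Im (f n) @[n --> \oo] --> b ->
  f n @[n --> \oo] --> ((a%:C : cplx R) + ('i%C : cplx R) * (b%:C : cplx R)).
Proof.
move=> fa fb.
have cre : (fun n => (complex.Re (f n))%:C : cplx R) @ \oo --> (a%:C : cplx R).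
  exact: cvg_complex_of_real.
have cim : (fun n => (complex.Im (f n))%:C : cplx R) @ \oo --> (b%:C : cplx R).
  exact: cvg_complex_of_real.
have cf := cvgD cre (cvgM (cvg_cst ('i%C : cplx R)) cim).
have -> : f = (fun n => (complex.Re (f n))%:C : cplx R) +
    (fun=> 'i%C : cplx R) \* (fun n => (complex.Im (f n))%:C : cplx R).
  by apply/funext => n; exact: complexE.
exact: cf.
Qed.

Lemma cvg_expc {R : realType} (z : cplx R) : `|z| < 1 ->
  z ^+ n @[n --> \oo] --> (0 : cplx R).
Proof.
move=> z1; apply: norm_cvg0; have zE := ge0_complexE _ (normr_ge0 z).
rewrite (_ : (fun n => `|z ^+ n|) = fun n => ((complex.Re `|z|) ^+ n)%:C);
  last first.
  by apply/funext => n; rewrite normrX rmorphXn /= -zE.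
apply: cvg_complex_of_real; apply: cvg_expr.
have := normr_ge0 z; rewrite zE ler0c => z0; rewrite ger0_norm //=.
by move: z1; rewrite zE (_ : 1 = 1%:C) // ltcR.
Qed.

(** Real and imaginary parts converge absolutely by comparison with a real geometric series. *)
Lemma cvg_series_geometric_dominated {R : realType} (a : nat -> cplx R)
    (M r : cplx R) :
  0 <= r -> r < 1 -> (forall n, `|a n| <= M * r ^+ n) ->
  exists l : cplx R, series a n @[n --> \oo] --> l.
Proof.
move=> r0 r1 aM.
have M0 : 0 <= M by have := aM 0%N; rewrite expr0 mulr1; apply: le_trans.
have rE := ge0_complexE _ r0; have ME := ge0_complexE _ M0.
have re_cvg (b : nat -> cplx R) : (forall n, `|b n| <= M * r ^+ n) ->
    cvgn (series (fun n => complex.Re (b n))).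
  move=> bM; apply: normed_cvg.
  apply: (@series_le_cvg _ _ (geometric (complex.Re M) (complex.Re r))) =>
    [n|n|n|] //=.
  - by rewrite mulr_ge0 ?exprn_ge0 // -ler0c -?ME -?rE.
  - rewrite -lecR rmorphM rmorphXn /= -ME -rE.
    exact: le_trans (normc_ge_Re _) (bM n).
  - apply: is_cvg_geometric_series.
    by rewrite ger0_norm; [rewrite -ltcR -rE|rewrite -ler0c -rE].
have re_sum (b : nat -> cplx R) n :
    series (fun n => complex.Re (b n)) n = complex.Re (series b n).
  rewrite /series /= (big_morph (@complex.Re R) (id1 := 0) (op1 := +%R)) //.
  by case=> ? ? [].
have /re_cvg cre := aM.
(* The imaginary part is reduced to the real case by [Re (z i) = - Im z], and multiplication by [i]
   keeps the bound. *)
have /re_cvg cim : forall n, `|a n * 'i%C| <= M * r ^+ n.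
  move=> n; rewrite normrM (normc_def 'i%C) /= expr0n add0r expr1n.
  by rewrite sqrtr1 mulr1.
eexists; apply: cvg_complex.
  rewrite (_ : (fun n => _) = series (fun n => complex.Re (a n))).
    exact: cre.
  by apply/funext => n; rewrite re_sum.
rewrite (_ : (fun n => _) = - series (fun n => complex.Re (a n * 'i%C))).
  by apply: cvgN; exact: cim.
apply/funext => n; rewrite /= [RHS]/GRing.opp /= re_sum.
have -> : series (fun n => a n * 'i%C) n = series a n * 'i%C.
  by rewrite /series /= mulr_suml.
by rewrite ReiNIm opprK.
Qed.

(** By [1 + t <= exp t], the product is at most the exponential of a geometric sum, itself at most
    [c / (1 - r)]. *)
Lemma prod_geometric_bound {R : realType} (c r : cplx R) :
  0 <= c -> 0 <= r -> r < 1 ->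
  exists2 M, 0 < M & forall n, \prod_(i < n) (1 + c * r ^+ i) <= M.
Proof.
move=> c0 r0 r1; have cE := ge0_complexE _ c0; have rE := ge0_complexE _ r0.
rewrite {}cE {}rE !ler0c (_ : 1 = 1%:C) ?ltcR // in c0 r0 r1 *.
set c' := complex.Re c in c0 *; set r' := complex.Re r in r0 r1 *.
exists (expR (c' / (1 - r')))%:C.
  by rewrite (_ : 0 = 0%:C) // ltcR expR_gt0.
move=> n.
have -> : \prod_(i < n) (1%:C + c'%:C * r'%:C ^+ i) =
    (\prod_(i < n) (1 + c' * r' ^+ i))%:C.
  rewrite rmorph_prod; apply: eq_bigr => i _.
  by rewrite rmorphD rmorphM rmorphXn.
rewrite lecR; apply: (@le_trans _ _ (expR (\sum_(i < n) c' * r' ^+ i))).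
  elim: n => [|n IH]; first by rewrite !big_ord0 expR0.
  rewrite !big_ord_recr /= expRD ler_pM ?expR_ge1Dx //.
    by apply: prodr_ge0 => i _; rewrite addr_ge0 // mulr_ge0 // exprn_ge0.
  by rewrite addr_ge0 // mulr_ge0 // exprn_ge0.
rewrite ler_expR -mulr_sumr ler_wpM2l // -[leRHS]mul1r ler_pdivlMr ?subr_gt0 //.
by rewrite mulrC -opprB mulNr -subrX1 opprB gerBl exprn_ge0.
Qed.


(** * Unordered sums computed along an exhaustion *)

Lemma sum_uniq_subset (I : eqType) (V : zmodType) (s t : seq I) (F : I -> V) :
  uniq s -> uniq t -> {subset s <= t} ->
  \sum_(i <- t) F i = \sum_(i <- s) F i + \sum_(i <- t | i \notin s) F i.
Proof.
move=> us ut st; rewrite (bigID (mem s)) /=; congr (_ + _).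
rewrite -big_filter; apply: perm_big; apply: uniq_perm; rewrite ?filter_uniq //.
by move=> i; rewrite mem_filter; case: (boolP (i \in s)) => // /st ->.
Qed.

(** A finite set [A] containing [s n] lies in some [s k]; the norm of the sum over [A] outside [s n]
    is then at most a difference of two partial sums of norms, which is small by the Cauchy
    property. *)
Lemma has_sum_exhaustion (I : choiceType) (K : numFieldType) (f : I -> K)
    (s : nat -> seq I) (l v : K) :
  (forall n, uniq (s n)) ->
  (forall m n, (m <= n)%N -> {subset s m <= s n}) ->
  (forall i, exists n, i \in s n) ->
  \sum_(i <- s n) `|f i| @[n --> \oo] --> l ->
  \sum_(i <- s n) f i @[n --> \oo] --> v -> has_sum f v.
Proof.
move=> us smono scover sl sv; have := @summability.totally_filter I => ?.
apply/cvgrPdist_lt => e e0.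
have e4 : 0 < e / 4 by rewrite divr_gt0.
have [n0 _ n0l] := (cvgrPdist_lt _ _).1 sl _ e4.
have [n1 _ n1v] := (cvgrPdist_lt _ _).1 sv _ e4.
pose n := maxn n0 n1.
exists [fset i | i in s n]%fset => // A /= sA.
have subA : {subset s n <= enum_fset A}.
  by move=> i si; apply: (fsubsetP sA); rewrite inE.
have [k nk Ak] : exists2 k, (n <= k)%N & {subset enum_fset A <= s k}.
  elim: (enum_fset A) {subA sA} => [|i t [k nk tk]]; first by exists n.
  have [m im] := scover i; exists (maxn m k); first by rewrite leq_max nk orbT.
  move=> j; rewrite inE => /predU1P[->|/tk].
    exact: smono (leq_maxl _ _) _ im.
  exact: smono (leq_maxr _ _) _.
rewrite /summability.partial_sum -(big_seq_fsetE _ _ xpredT f) /=.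
rewrite (sum_uniq_subset _ _ _ _ f (us n) (fset_uniq A) subA).
set d := \sum_(i <- A | i \notin s n) f i.
have dle : `|d| < e / 4 + e / 4.
  have : `|d| <= \sum_(i <- s k) `|f i| - \sum_(i <- s n) `|f i|.
    rewrite (sum_uniq_subset _ _ _ _ _ (fset_uniq A) (us k) Ak).
    rewrite (sum_uniq_subset _ _ _ _ _ (us n) (fset_uniq A) subA).
    rewrite addrAC (addrAC _ _ (- _)) subrr add0r.
    apply: (le_trans (ler_norm_sum _ _ _)).
    by rewrite lerDl sumr_ge0.
  move=> /le_lt_trans; apply; rewrite -[ltLHS]ger0_norm; last first.
    rewrite subr_ge0 (sum_uniq_subset _ _ _ _ _ (us n) (us k) (smono _ _ nk)).
    by rewrite lerDl sumr_ge0.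
  rewrite -(subrKA l); apply: (le_lt_trans (ler_normD _ _)); rewrite ltrD //.
    by rewrite distrC; apply: n0l; exact: leq_trans (leq_maxl _ _) nk.
  by apply: n0l; exact: leq_maxl.
rewrite opprD addrA; apply: (le_lt_trans (ler_normB _ _)).
have -> : e = e / 4 + (e / 4 + e / 4) + e / 4 by field.
rewrite ltr_wpDr ?(ltW e4) // ltrD // n1v //; exact: leq_maxr.
Qed.

(** * Tannery's theorem for sums of products *)

Lemma cvg_sum_ord (K : numFieldType) (n : nat) (f : nat -> nat -> K)
    (g : nat -> K) :
  (forall i, f N i @[N --> \oo] --> g i) ->
  \sum_(i < n) f N i @[N --> \oo] --> \sum_(i < n) g i.
Proof.
move=> fg; elim: n => [|n IH].
  by under eq_fun do rewrite big_ord0; rewrite big_ord0; exact: cvg_cst.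
by under eq_fun do rewrite big_ord_recr; rewrite big_ord_recr; exact: cvgD.
Qed.

Lemma cvg_prod_ord (K : numFieldType) (n : nat) (f : nat -> nat -> K)
    (g : nat -> K) :
  (forall i, f N i @[N --> \oo] --> g i) ->
  \prod_(i < n) f N i @[N --> \oo] --> \prod_(i < n) g i.
Proof.
move=> fg; elim: n => [|n IH].
  by under eq_fun do rewrite big_ord0; rewrite big_ord0; exact: cvg_cst.
by under eq_fun do rewrite big_ord_recr; rewrite big_ord_recr; exact: cvgM.
Qed.

(** With [t = c r^i], the bound [t <= (1 + 2t) / 2] extracts a factor 1/2 from each term and leaves
    a bounded product, even when [c] is large. *)
Lemma prod_le_geometric {R : realType} (c r : cplx R) :
  0 <= c -> 0 <= r -> r < 1 ->
  exists2 M, 0 < M & forall (u : nat -> cplx R) n,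
    (forall i, `|u i| <= c * r ^+ i) -> `|\prod_(i < n) u i| <= M * 2^-1 ^+ n.
Proof.
move=> c0 r0 r1.
have [M M0 PM] :=
  prod_geometric_bound (2 * c) r (mulr_ge0 (ler0n _ 2) c0) r0 r1.
exists M => // u n uc; rewrite normr_prod.
apply: (@le_trans _ _ (\prod_(i < n) ((1 + 2 * c * r ^+ i) / 2))).
  apply: ler_prod => i _; rewrite normr_ge0 /= (le_trans (uc i)) //.
  by rewrite ler_pdivlMr // mulrC mulrA lerDr.
rewrite big_split /= prodr_const card_ord ler_wpM2r //.
exact: PM.
Qed.

Lemma cvg_half {R : realType} :
  (2^-1 : cplx R) ^+ n @[n --> \oo] --> (0 : cplx R).
Proof. by apply: cvg_expc; rewrite ger0_norm ?invr_ge0 // invf_lt1 ?ltr1n. Qed.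

(** The sum is cut at a fixed index [K]: the tail is small uniformly in [N] by domination, and the
    finitely many remaining terms tend to 0. *)
Lemma cvg_sum_dominated {R : realType} (d : nat -> nat -> cplx R) (D : cplx R) :
  (forall N n, `|d N n| <= D * 2^-1 ^+ n) ->
  (forall n, d N n @[N --> \oo] --> (0 : cplx R)) ->
  \sum_(n < N.+1) d N n @[N --> \oo] --> (0 : cplx R).
Proof.
move=> dD d0; apply/cvgrPdist_lt => e e0.
have D0 : 0 <= D by have := dD 0%N 0%N; rewrite expr0 mulr1; apply: le_trans.
have e2 : 0 < e / 2 by rewrite divr_gt0.
(* The quantity [D * 2 * 2^-1 ^+ K] bounds the whole tail from index [K] on. *)
have [K _ KP] : \forall K \near \oo, `|0 - D * 2 * 2^-1 ^+ K| < e / 2.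
  apply: (cvgrPdist_lt _ _).1 e2; rewrite -[0](mulr0 (D * 2)).
  by apply: cvgM; [exact: cvg_cst|exact: cvg_half].
have {KP} := KP K (leqnn K); rewrite sub0r normrN => KP.
have tail m : \sum_(K <= n < K + m) 2^-1 ^+ n <= 2 * 2^-1 ^+ K :> cplx R.
  suff -> : \sum_(K <= n < K + m) 2^-1 ^+ n =
      2 * 2^-1 ^+ K * (1 - 2^-1 ^+ m) :> cplx R.
    have half_ge0 j : 0 <= 2^-1 ^+ j :> cplx R by rewrite exprn_ge0 // invr_ge0.
    by apply: ler_piMr; [rewrite mulr_ge0|rewrite gerBl].
  elim: m => [|m IH]; first by rewrite addn0 big_geq // subrr mulr0.
  by rewrite addnS big_nat_recr ?leq_addr //= IH exprD exprS; field.
have := cvg_sum_ord _ K d (fun=> 0) d0; rewrite big1_eq.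
move=> /cvgrPdist_lt /(_ _ e2)[N0 _ N0P].
exists (maxn N0 K) => // N /=; rewrite geq_max => /andP[/N0P N0N KN].
rewrite -(big_mkord xpredT (d N)) (big_cat_nat (n := K)) //=; last exact: leqW.
rewrite big_mkord opprD addrA; apply: (le_lt_trans (ler_normB _ _)).
have -> : e = e / 2 + e / 2 by field.
apply: ltr_leD; first exact: N0N.
apply: (le_trans (ler_norm_sum _ _ _)).
apply: (le_trans (ler_sum _ (fun n _ => dD N n))).
rewrite -mulr_sumr -(subnKC (leqW KN)).
apply: (le_trans (ler_wpM2l D0 (tail _))); rewrite mulrA.
by rewrite (le_trans _ (ltW KP)) // ger0_norm // !mulr_ge0.
Qed.

(** Stating the result for the difference avoids assuming that either sum converges. *)
Lemma cvg_sum_prod {R : realType} (u : nat -> nat -> cplx R)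
    (v : nat -> cplx R) (c r : cplx R) :
  0 <= r -> r < 1 ->
  (forall N i, `|u N i| <= c * r ^+ i) -> (forall i, `|v i| <= c * r ^+ i) ->
  (forall i, u N i @[N --> \oo] --> v i) ->
  \sum_(n < N.+1) \prod_(i < n) u N i - \sum_(n < N.+1) \prod_(i < n) v i
    @[N --> \oo] --> (0 : cplx R).
Proof.
move=> r0 r1 uc vc uv.
have c0 : 0 <= c by have := vc 0%N; rewrite expr0 mulr1; apply: le_trans.
have [M M0 PM] := prod_le_geometric _ _ c0 r0 r1.
under eq_fun do rewrite -sumrB.
apply: (@cvg_sum_dominated _
  (fun N n => \prod_(i < n) u N i - \prod_(i < n) v i) (M * 2)) => [N n|n].
  rewrite mulrAC mulr_natr mulr2n; apply: (le_trans (ler_normB _ _)).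
  by rewrite lerD ?PM.
rewrite -(subrr (\prod_(i < n) v i)); apply: cvgB; last exact: cvg_cst.
exact: cvg_prod_ord.
Qed.

(** * Infinite q-Pochhammer symbols *)

(** The partial products are bounded, so their successive differences [d n] are dominated by a
    geometric sequence and form a convergent telescoping series. *)
Lemma cvg_qpoch {R : realType} (a b : cplx R) : `|b| < 1 ->
  qpoch a b n @[n --> \oo] --> qpoch_inf a b.
Proof.
move=> b1.
have [M _ PM] := prod_geometric_bound _ _ (normr_ge0 a) (normr_ge0 b) b1.
have qM n : `|qpoch a b n| <= M.
  rewrite normr_prod; apply: le_trans (PM n); apply: ler_prod => i _.
  rewrite normr_ge0 (le_trans (ler_normB _ _)) // normr1 normrM normrX //.
pose d n := - qpoch a b n * (a * b ^+ n).
have [|l dl] := cvg_series_geometric_dominated d (M * `|a|) _ (normr_ge0 b) b1.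
  by move=> n; rewrite !normrM normrN normrX mulrA !ler_wpM2r ?exprn_ge0.
have ql : qpoch a b n @[n --> \oo] --> (1 + l : cplx R).
  rewrite (_ : qpoch a b = (fun n => 1 + series d n)); last first.
    apply/funext; elim=> [|n IH].
      by rewrite /qpoch big_ord0 seriesEord /= big_ord0 addr0.
    rewrite seriesEord /= in IH *; rewrite [in RHS]big_ord_recr /= addrA -IH.
    by rewrite [LHS]big_ord_recr /= mulrBr mulr1 /d mulNr.
  by apply: cvgD; [exact: cvg_cst|exact: dl].
by rewrite /qpoch_inf (norm_cvg_lim ql).
Qed.

(** The inverses of the factors are dominated by the factors of a bounded product, which keeps the
    partial products away from 0. *)
Lemma qpoch_inf_neq0 {R : realType} (a b : cplx R) : `|a| < 1 -> `|b| < 1 ->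
  qpoch_inf a b != 0.
Proof.
move=> a1 b1; have a1' : 0 < 1 - `|a| by rewrite subr_gt0.
have c0 : 0 <= `|a| / (1 - `|a|) by rewrite divr_ge0 // ltW.
have [M M0 PM] := prod_geometric_bound _ _ c0 (normr_ge0 b) b1.
have qM n : M^-1 <= `|qpoch a b n|.
  (* With [A = |a|] and [t = |b|^i] in [[0, 1]], the claim is [(1 - A t)(1 + k t) >= 1]; the choice
     [k = A / (1 - A)] gives equality at [t = 1]. *)
  have factor i : (1 + `|a| / (1 - `|a|) * `|b| ^+ i)^-1 <= `|1 - a * b ^+ i|.
    have bi0 : 0 <= `|b| ^+ i by rewrite exprn_ge0.
    have bi1 : `|b| ^+ i <= 1 by rewrite exprn_ile1 // ltW.
    have s0 : 0 <= `|a| / (1 - `|a|) * `|b| ^+ i by rewrite mulr_ge0.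
    apply: (@le_trans _ _ (1 - `|a| * `|b| ^+ i)); last first.
      by rewrite -normrX -normrM -[X in X - _]normr1 lerB_dist.
    rewrite -[leLHS]mul1r ler_pdivrMr; last by rewrite ltr_wpDr.
    have -> : (1 - `|a| * `|b| ^+ i) * (1 + `|a| / (1 - `|a|) * `|b| ^+ i) =
      1 + `|a| ^+ 2 / (1 - `|a|) * `|b| ^+ i * (1 - `|b| ^+ i).
      by field; rewrite gt_eqF.
    by rewrite lerDl !mulr_ge0 ?exprn_ge0 ?invr_ge0 ?(ltW a1') // subr_ge0.
  have p0 i : 0 < 1 + `|a| / (1 - `|a|) * `|b| ^+ i.
    by rewrite ltr_wpDr // mulr_ge0 // exprn_ge0.
  apply: (@le_trans _ _ (\prod_(i < n) (1 + `|a| / (1 - `|a|) * `|b| ^+ i)^-1)).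
    rewrite prodfV lef_pV2 ?posrE //; apply: prodr_gt0 => i _; exact: p0.
  rewrite normr_prod; apply: ler_prod => i _.
  by rewrite factor andbT invr_ge0 ltW.
apply/eqP => q0; have := cvg_qpoch a b b1; rewrite q0.
have Mi0 : 0 < M^-1 by rewrite invr_gt0.
move=> /cvgrPdist_lt /(_ _ Mi0)[n _ /(_ n (leqnn n))].
by rewrite sub0r normrN => /(le_lt_trans (qM n)); rewrite ltxx.
Qed.

(** * The series as a limit of finite sums *)

Lemma one_sub_neq0 {K : numFieldType} (z : K) : `|z| < 1 -> 1 - z != 0.
Proof. by apply: contraTneq => /subr0_eq <-; rewrite normr1 ltxx. Qed.

Lemma ler_norm_inv1B {K : numFieldType} (z r : K) : `|z| <= r -> r < 1 ->
  `|(1 - z)^-1| <= (1 - r)^-1.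
Proof.
move=> zr r1; rewrite normfV lef_pV2 ?posrE ?subr_gt0 //; last first.
  by rewrite normr_gt0 one_sub_neq0 // (le_lt_trans zr).
apply: (@le_trans _ _ (1 - `|z|)); first by rewrite lerD2l lerN2.
by rewrite -[X in X - _]normr1 lerB_dist.
Qed.

Lemma ler_norm_exp {K : numFieldType} (q : K) n : `|q| < 1 -> (0 < n)%N ->
  `|q ^+ n| <= `|q|.
Proof.
by case: n => // n q1 _; rewrite normrX exprS ler_piMr // exprn_ile1 // ltW.
Qed.

(** For [y = -1], the ratio of the terms of index [i + 1] and [i] of the series; for general [y],
    the factor of [sum_P4_words] with its geometric sum completed. *)
Definition P4_factor {K : fieldType} (x y q : K) (i : nat) : K :=
  q ^+ i.*2.+1 * (x + y * q ^+ i.*2.+1) / (1 - q ^+ (4 * i.+1)).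

Lemma P4_factor_num_le {K : numFieldType} (x y q : K) i :
  `|q| < 1 -> `|y| <= 1 ->
  `|q ^+ i.*2.+1 * (x + y * q ^+ i.*2.+1)| <= (`|x| + 1) * `|q| ^+ i.
Proof.
move=> q1 y1; have q1' := ltW q1; rewrite normrM mulrC ler_pM //.
  apply: (le_trans (ler_normD _ _)); rewrite lerD2l normrM normrX.
  by rewrite mulr_ile1 // ?exprn_ge0 // exprn_ile1.
rewrite normrX ler_wiXn2l //; lia.
Qed.

Lemma P4_factor_le {K : numFieldType} (x y q : K) i :
  `|q| < 1 -> `|y| <= 1 ->
  `|P4_factor x y q i| <= (`|x| + 1) / (1 - `|q|) * `|q| ^+ i.
Proof.
move=> q1 y1; rewrite /P4_factor normrM mulrAC ler_pM //.
  exact: P4_factor_num_le.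
by apply: ler_norm_inv1B => //; apply: ler_norm_exp.
Qed.

(** Serves both limits: [w] is the missing tail of a geometric sum in one, and comes from the
    numerator of a Gaussian binomial in the other. The constant 2 in the proof bounds
    [1 - w N i]. *)
Lemma cvg_sum_P4_factor_perturbed {R : realType} (x y q : cplx R)
    (w : nat -> nat -> cplx R) :
  `|q| < 1 -> `|y| <= 1 -> (forall N i, `|w N i| <= 1) ->
  (forall i, w N i @[N --> \oo] --> (0 : cplx R)) ->
  \sum_(n < N.+1) \prod_(i < n) (P4_factor x y q i * (1 - w N i))
    - \sum_(n < N.+1) \prod_(i < n) P4_factor x y q i
    @[N --> \oo] --> (0 : cplx R).
Proof.
move=> q1 y1 w1 w0; have q1' : 0 < 1 - `|q| by rewrite subr_gt0.
have f_le := fun i => P4_factor_le x y q i q1 y1.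
pose u N i := P4_factor x y q i * (1 - w N i).
apply: (cvg_sum_prod u _ ((`|x| + 1) / (1 - `|q|) * 2) `|q|).
- exact: normr_ge0.
- exact: q1.
- move=> N i; rewrite /u normrM mulrAC ler_pM // (le_trans (ler_normB _ _)) //.
  by rewrite normr1 -[2]/(1 + 1) lerD2l.
- move=> i; rewrite mulrAC (le_trans (f_le i)) // ler_peMr ?ler1n //.
  by rewrite mulr_ge0 ?exprn_ge0 ?divr_ge0 ?(ltW q1') ?addr_ge0.
- move=> i; rewrite -[X in _ --> X]mulr1; apply: cvgM; first exact: cvg_cst.
  by rewrite -[X in _ --> X]subr0; apply: cvgB; [exact: cvg_cst|exact: w0].
Qed.

Lemma sum_P4_words_asymp {R : realType} (x y q : cplx R) :
  `|q| < 1 -> `|y| <= 1 ->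
  \sum_(n < N.+1) \sum_(c <- P4_words N n) parts_weight x y q (P4_parts c)
    - \sum_(n < N.+1) \prod_(i < n) P4_factor x y q i
    @[N --> \oo] --> (0 : cplx R).
Proof.
move=> q1 y1; pose u N i := P4_factor x y q i * (1 - (q ^+ (4 * i.+1)) ^+ N).
have q4 i : `|q ^+ (4 * i.+1)| < 1.
  by rewrite (le_lt_trans _ q1) // ler_norm_exp // muln_gt0.
have uE N i : q ^+ i.*2.+1 * (x + y * q ^+ i.*2.+1)
    * \sum_(j < N) (q ^+ (4 * i.+1)) ^+ j = u N i.
  rewrite /u /P4_factor -[1 - _ ^+ N]opprB subrX1 -mulNr opprB mulrA divfK //.
  exact: one_sub_neq0.
under eq_fun => N do under eq_bigr => n _ do rewrite sum_P4_words.
under eq_fun => N do under eq_bigr => n _ do under eq_bigr => i _ do rewrite uE.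
apply: (cvg_sum_P4_factor_perturbed x y q
  (fun N i => (q ^+ (4 * i.+1)) ^+ N) q1 y1) => [N i|i].
  by rewrite normrX exprn_ile1 // ltW.
exact: cvg_expc.
Qed.

(** Since [c = - b], the denominators of [qterm] and of the Gaussian binomial multiply to [(1 +
    b^(i+1)) (1 - b^(i+1)) = 1 - q^(4(i+1))]. *)
Lemma qterm_P4_factor {K : numFieldType} (x q : K) i : `|q| < 1 ->
  qterm (q ^+ 2) (- q ^+ 2) (- (x * q)) i / (1 - (q ^+ 2) ^+ i.+1) =
  P4_factor x (-1) q i.
Proof.
move=> q1; rewrite /qterm /P4_factor.
have -> : (4 * i.+1 = i.+1 * 2 * 2)%N by lia.
have q2 n : (0 < n)%N -> `|q ^+ n| < 1.
  by move=> n0; rewrite (le_lt_trans _ q1) // ler_norm_exp.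
have h1 : 1 - (q ^+ 2) ^+ i.+1 != 0 by rewrite one_sub_neq0 // -exprM q2.
have h2 : 1 + (q ^+ 2) ^+ i.+1 != 0.
  by rewrite -[_ ^+ i.+1]opprK one_sub_neq0 // normrN -exprM q2.
have -> : q ^+ (i.+1 * 2 * 2) = ((q ^+ 2) ^+ i.+1) ^+ 2.
  by rewrite -!exprM; congr (_ ^+ _); lia.
have -> : q ^+ i.*2.+1 = q * (q ^+ 2) ^+ i by rewrite exprS -exprM mul2n.
rewrite exprS in h1 h2 *; set t := (q ^+ 2) ^+ i in h1 h2 *.
have h3 : 1 - (q ^+ 2 * t) ^+ 2 != 0.
  have -> : 1 - (q ^+ 2 * t) ^+ 2 = (1 - q ^+ 2 * t) * (1 + q ^+ 2 * t) by ring.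
  by rewrite mulf_neq0.
by field; rewrite h1 h3 /=; move: h2; rewrite mulNr opprK.
Qed.

Lemma cvg_sum_P4_factor {R : realType} (x q : cplx R) : `|q| < 1 ->
  \sum_(n < N.+1) \prod_(i < n) P4_factor x (-1) q i @[N --> \oo] -->
  qpoch_inf (- (x * q)) (q ^+ 2) / qpoch_inf (- q ^+ 2) (q ^+ 2).
Proof.
move=> q1; pose b := q ^+ 2.
have b1 : `|b| < 1 by rewrite (le_lt_trans _ q1) // ler_norm_exp.
have bX i : `|b ^+ i.+1| < 1 by rewrite (le_lt_trans _ b1) // ler_norm_exp.
pose u N i := P4_factor x (-1) q i * (1 - b ^+ (N - i)).
have uE N n : qbinom b N n * \prod_(i < n) qterm b (- b) (- (x * q)) i =
    \prod_(i < n) u N i.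
  rewrite -big_split; apply: eq_bigr => i _ /=.
  rewrite /u -qterm_P4_factor // mulrAC [RHS]mulrAC; congr (_ / _).
  exact: mulrC.
have lim_ratio : \sum_(n < N.+1) \prod_(i < n) u N i @[N --> \oo] -->
    qpoch_inf (- (x * q)) b / qpoch_inf (- b) b.
  have -> : (fun N => \sum_(n < N.+1) \prod_(i < n) u N i) =
      (fun N => qpoch (- (x * q)) b N / qpoch (- b) b N).
    apply/funext => N; under eq_bigr do rewrite -uE.
    rewrite qbinom_sum => [|i|i].
    - by rewrite big_split prodfV.
    - by rewrite -subr_eq0 -opprB oppr_eq0 one_sub_neq0.
    - by rewrite one_sub_neq0 // mulNr normrN -exprS.
  apply: cvgM; first exact: cvg_qpoch.
  apply: cvgV; last exact: cvg_qpoch.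
  by rewrite qpoch_inf_neq0 // normrN.
have diff : \sum_(n < N.+1) \prod_(i < n) u N i
    - \sum_(n < N.+1) \prod_(i < n) P4_factor x (-1) q i
    @[N --> \oo] --> (0 : cplx R).
  have n1 : `|-1 : cplx R| <= 1 by rewrite normrN1.
  apply: (cvg_sum_P4_factor_perturbed x (-1) q (fun N i => b ^+ (N - i)) q1 n1).
    by move=> N i; rewrite normrX exprn_ile1 // ltW.
  (* Shifting [N] by [i] removes the truncated subtraction. *)
  move=> i; rewrite -(cvg_shiftn i) /=; under eq_fun do rewrite addnK.
  exact: cvg_expc.
rewrite (_ : (fun N => \sum_(n < N.+1) \prod_(i < n) P4_factor x (-1) q i) =
    (fun N => \sum_(n < N.+1) \prod_(i < n) u N i -
      (\sum_(n < N.+1) \prod_(i < n) u N i -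
       \sum_(n < N.+1) \prod_(i < n) P4_factor x (-1) q i))); last first.
  by apply/funext => N; rewrite opprB addrC subrK.
by rewrite -[X in _ --> X]subr0; apply: cvgB; [exact: lim_ratio|exact: diff].
Qed.

(** * Exhaustion of the partitions by finite lists *)

Definition P4_of_word (c : seq (bool * nat)) : P4 :=
  exist is_P4 (rev (P4_parts c))
    (etrans (is_P4E _) (etrans (congr1 is_P4_rev (revK _)) (is_P4_parts c))).

Lemma P4_of_word_inj : injective P4_of_word.
Proof. by move=> c d [/(can_inj revK)/P4_parts_inj]. Qed.

Lemma P4_of_word_onto l : exists c, l = P4_of_word c.
Proof.
case: l => s sP; have := sP; rewrite is_P4E => /P4_parts_onto[c cE].
by exists c; apply: val_inj; rewrite /= -cE revK.
Qed.

Lemma P4_weight_of_word {K : numFieldType} (x q : K) c :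
  P4_weight x q (P4_of_word c) = parts_weight x (-1) q (P4_parts c).
Proof.
by rewrite /P4_weight /parts_weight /nb_odd /nb_even /= !count_rev sumn_rev.
Qed.

(** One parameter bounds both the number of parts and the quotients, so that these finite lists
    increase and cover everything. *)
Definition P4_enum (N : nat) : seq P4 :=
  [seq P4_of_word c | n <- iota 0 N.+1, c <- P4_words N n].

Lemma P4_enumP N c :
  (P4_of_word c \in P4_enum N) = (size c <= N)%N && all (fun a => a.2 < N)%N c.
Proof.
apply/allpairsPdep/idP => [[n [d [nN dP /P4_of_word_inj ->]]]|/andP[cN aN]].
  move: dP nN; rewrite P4_wordsP mem_iota => /andP[/eqP-> ->].
  by rewrite andbT.
exists (size c), c; split => //; first by rewrite mem_iota.
by rewrite P4_wordsP eqxx.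
Qed.

Lemma uniq_P4_enum N : uniq (P4_enum N).
Proof.
apply: allpairs_uniq_dep => [|n _|]; rewrite ?iota_uniq ?uniq_P4_words //.
move=> _ _ /allpairsPdep[n [c [_ cP ->]]] /allpairsPdep[m [d [_ dP ->]]] /=.
move=> /P4_of_word_inj cd; move: cP dP; rewrite cd !P4_wordsP.
by move=> /andP[/eqP-> _] /andP[/eqP-> _].
Qed.

Lemma P4_enum_mono m n : (m <= n)%N -> {subset P4_enum m <= P4_enum n}.
Proof.
move=> mn l; have [c ->] := P4_of_word_onto l; rewrite !P4_enumP.
move=> /andP[/leq_trans-> //=]; apply: sub_all => a /leq_trans; exact.
Qed.

Lemma P4_enum_cover l : exists N, l \in P4_enum N.
Proof.
have [c ->] := P4_of_word_onto l.
(* This number bounds the length of [c] and exceeds each of its quotients. *)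
exists (size c + \sum_(a <- c) a.2.+1)%N; rewrite P4_enumP leq_addr /=.
apply/allP => a ac; rewrite (big_rem a) //=; lia.
Qed.

(** * The two evaluations *)

(** The induction step combines [(1 - q^(2n+1) / x) x = x - q^(2n+1)], where [x] is nonzero, with
    [(n+1)^2 = n^2 + (2n+1)]. *)
Lemma qpoch_term_prod {K : numFieldType} (x q : K) n : x != 0 ->
  qpoch (q / x) (q ^+ 2) n * x ^+ n * q ^+ (n ^ 2) / qpoch (q ^+ 4) (q ^+ 4) n =
  \prod_(i < n) P4_factor x (-1) q i.
Proof.
move=> x0; elim: n => [|n IH]; first by
  rewrite /qpoch !big_ord0 exp0n // !expr0 invr1 !mulr1.
rewrite [RHS]big_ord_recr /= -IH /qpoch !big_ord_recr /= /P4_factor invfM.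
have -> : q ^+ (n.+1 ^ 2) = q ^+ (n ^ 2) * q ^+ n.*2.+1.
  by rewrite -exprD; congr (_ ^+ _); lia.
have -> : q / x * (q ^+ 2) ^+ n = q ^+ n.*2.+1 / x.
  by rewrite mulrAC -exprM -exprS mul2n.
have -> : q ^+ 4 * (q ^+ 4) ^+ n = q ^+ (4 * n.+1) by rewrite -exprS -exprM.
rewrite (exprS x); move: (\prod_(i < n) (1 - q ^+ 4 * _))^-1 => P.
move: (1 - q ^+ (4 * n.+1))^-1 (q ^+ n.*2.+1) (q ^+ (n ^ 2)) (x ^+ n).
move=> Q u v w.
by field.
Qed.

Lemma norm_P4_weight {K : numFieldType} (x q : K) c :
  `|P4_weight x q (P4_of_word c)| = parts_weight `|x| 1 `|q| (P4_parts c).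
Proof.
by rewrite P4_weight_of_word /parts_weight !normrM !normrX normrN normr1.
Qed.

Lemma sum_P4_enum {V : zmodType} (F : P4 -> V) N :
  \sum_(l <- P4_enum N) F l =
  \sum_(n < N.+1) \sum_(c <- P4_words N n) F (P4_of_word c).
Proof.
rewrite /P4_enum big_allpairs_dep -(big_mkord xpredT
  (fun n => \sum_(c <- P4_words N n) F (P4_of_word c))) /=.
by rewrite /index_iota subn0.
Qed.

Lemma has_sum_P4_weight {R : realType} (x q : cplx R) : `|q| < 1 ->
  has_sum (P4_weight x q)
    (qpoch_inf (- (x * q)) (q ^+ 2) / qpoch_inf (- q ^+ 2) (q ^+ 2)).
Proof.
move=> q1; have nq1 : `| `|q| | < 1 by rewrite normr_id.
have n1 : `|1 : cplx R| <= 1 by rewrite normr1.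
(* This series governs the sums of norms; only its convergence is needed, and domination provides
   it. *)
pose a n := \prod_(i < n) P4_factor `|x| 1 `|q| i.
have [l al] : exists l : cplx R, series a n @[n --> \oo] --> l.
  have c0 : 0 <= (`| `|x| | + 1) / (1 - `| `|q| |).
    by rewrite divr_ge0 ?subr_ge0 ?addr_ge0 // ltW.
  have [M _ aM] := prod_le_geometric _ _ c0 (normr_ge0 _) nq1.
  apply: (cvg_series_geometric_dominated _ M 2^-1).
  - by rewrite invr_ge0.
  - by rewrite invf_lt1 ?ltr1n.
  - by move=> n; apply: aM => i; exact: P4_factor_le.
apply: (has_sum_exhaustion _ _ _ P4_enum l).
- exact: uniq_P4_enum.
- exact: P4_enum_mono.
- exact: P4_enum_cover.
- under eq_fun => N do rewrite sum_P4_enum.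
  under eq_fun => N do under eq_bigr => n _ do
    under eq_bigr => c _ do rewrite norm_P4_weight.
  apply: cvg_sub0 (sum_P4_words_asymp _ _ _ nq1 n1) _.
  by move: al; rewrite -cvg_shiftS seriesEord.
- under eq_fun => N do rewrite sum_P4_enum.
  under eq_fun => N do under eq_bigr => n _ do
    under eq_bigr => c _ do rewrite P4_weight_of_word.
  apply: cvg_sub0 (sum_P4_words_asymp _ _ _ q1 _) (cvg_sum_P4_factor _ _ q1).
  by rewrite normrN1.
Qed.

Theorem theorem3p5 (R : realType) (x q : R[i]) (hx : x != 0) (hq : `|q| < 1) :
  let num := qpoch_inf (- (x * q)) (q ^+ 2) in
  let den := qpoch_inf (- q ^+ 2) (q ^+ 2) in
  [/\ qpoch (- (x * q)) (q ^+ 2) n @[n --> \oo] --> num,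
      qpoch (- q ^+ 2) (q ^+ 2) n @[n --> \oo] --> den /\ den != 0,
      has_sum (P4_weight x q) (num / den)
    & series (fun n : nat =>
        qpoch (q / x) (q ^+ 2) n * x ^+ n * q ^+ (n ^ 2)
          / qpoch (q ^+ 4) (q ^+ 4) n) n @[n --> \oo] --> num / den].
Proof.
have q2 : `|q ^+ 2| < 1 by rewrite (le_lt_trans _ hq) // ler_norm_exp.
split.
- exact: cvg_qpoch.
- by split; [exact: cvg_qpoch|rewrite qpoch_inf_neq0 // normrN].
- exact: has_sum_P4_weight.
- rewrite -cvg_shiftS seriesEord /=.
  under eq_fun => N do under eq_bigr => n _ do rewrite qpoch_term_prod //.
  exact: cvg_sum_P4_factor.
Qed.
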